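(* Let $K$ be a compact metric space and let $U\subset K$ be a dense open subset whose boundary $\partial U$ (in $K$) contains at least two points. Let $C(K)$ and $C(\partial U)$ be the spaces of all continuous complex-valued functions on $K$ and on $\partial U$ respectively, and for $h\in C(K)$ let $h_U$ denote the restriction of $h$ to $U$. Let $\Phi:M_b(U)\to M_b(U)$ be a Markov operator with the strong Feller property. Suppose that $\Phi$ satisfies the following two conditions: (A) For each point $x\in\partial U$ there exists $h\in C(K)$ such that $h(x)=0$, $h(y)<0$ for all $y\in K\setminus\{x\}$ (so $h$ is real-valued), and $\Phi(h_U)\ge h_U$ on $U$. (B) If $g\in C(K)$ is a real-valued function with $\Phi(g_U)\ge g_U$ on $U$, and if there exists $z\in U$ such that $g(z)=\max\{g(x):x\in K\}$, then $g$ is constant on $K$. Then for each $f\in C(\partial U)$ there exists a unique function $G\in C(K)$ such that $\Phi(G_U)=G_U$ and $G(x)=f(x)$ for all $x\in\partial U$. Moreover, if $F\in C(K)$ is an arbitrary continuous extension of $f$ to $K$, then the sequence $\{\Phi^n(F_U)\}_{n}$ converges uniformly on $U$ to $G_U$.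
   Context: For a locally compact Hausdorff space $E$, $M_b(E)$ denotes the space of all complex-valued, bounded, Borel measurable functions on $E$, and $C_b(E)$ denotes the set of all continuous functions in $M_b(E)$. A linear map $\Phi:M_b(E)\to M_b(E)$ is called a Markov operator if for each $x\in E$ there exists a Borel probability measure $\mu_x$ on $E$ such that $\Phi(f)(x)=\int f\,d\mu_x$ for all $f\in M_b(E)$. A Markov operator $\Phi$ on $M_b(E)$ has the strong Feller property if $\Phi(f)\in C_b(E)$ for every $f\in M_b(E)$. $\Phi^n$ denotes the $n$-fold composition of $\Phi$ with itself. Inequalities between real-valued functions are pointwise. *)

(* Defs.v *)
From HB Require Import structures.
From mathcomp Require Import all_boot all_order all_algebra.
From mathcomp Require Import complex.
From mathcomp Require Import all_classical all_reals all_analysis.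
From mathcomp Require Import measurable_realfun.

Set Implicit Arguments.
Unset Strict Implicit.
Unset Printing Implicit Defensive.

Import Order.TTheory GRing.Theory Num.Theory.
Import numFieldNormedType.Exports.

Local Open Scope classical_set_scope.
Local Open Scope ring_scope.
Local Open Scope complex_scope.

Definition boundary {T : topologicalType} (A : set T) : set T :=
  closure A `\` A°.

Definition borel_set {E : topologicalType} : set (set E) := <<s open >>.

Definition borel_fun {E F : topologicalType} (f : E -> F) : Prop :=
  forall B, borel_set B -> borel_set (f @^-1` B).

(* Measurable types must be pointed in the library; [x] only serves as that    *)
(* point, the measurable sets of [borel_space x] are the Borel sets of E.      *)
Definition pointed_at {E : Type} (x : E) : Type := E.

HB.instance Definition _ (E : topologicalType) (x : E) :=
  Topological.on (pointed_at x).
HB.instance Definition _ (E : topologicalType) (x : E) :=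
  isPointed.Build (pointed_at x) x.

Notation borel_space x := (g_sigma_algebraType (@open (pointed_at x))).

(* Complex-valued functions take values in R[i]^o rather than R[i]: the norm   *)
(* topology and the module structure over R[i] are attached to the former.     *)
(* The order of R[i] is partial: z <= w (resp. z < w) means Im z = Im w and    *)
(* Re z <= Re w (resp. Re z < Re w).                                           *)
Section complex_borel.
Context {R : realType} {E : topologicalType}.
Implicit Types (f g : E -> R[i]^o) (x : E).

Lemma continuous_Re : continuous (fun z : R[i]^o => complex.Re z : R^o).
Proof.
move=> z A /nbhs_ballP[e /= e0 eA].
apply/nbhs_ballP; exists e%:C => [|w]; first by rewrite /= ltcR.
rewrite -ball_normE /= => zw; apply: eA; rewrite -ball_normE /= -ltcR.
apply: le_lt_trans zw.
have := normc_ge_Re (z - w).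
by case: z w => [a b] [c d].
Qed.

Lemma continuous_Im : continuous (fun z : R[i]^o => complex.Im z : R^o).
Proof.
move=> z A /nbhs_ballP[e /= e0 eA].
apply/nbhs_ballP; exists e%:C => [|w]; first by rewrite /= ltcR.
rewrite -ball_normE /= => zw; apply: eA; rewrite -ball_normE /= -ltcR.
apply: le_lt_trans zw.
have := normc_ge_Re ((z - w) * 'i).
rewrite normrM (_ : `|'i| = 1) ?mulr1; last first.
  by rewrite normc_def /= expr0n expr1n add0r sqrtr1.
case: z w => [a b] [c d] /=.
by rewrite !(mul0r, mulr0, mulr1, mul1r, add0r, addr0) normrN.
Qed.

Lemma norm_le_ReIm (z : R[i]) :
  `|z| <= (`|complex.Re z| + `|complex.Im z|)%:C.
Proof.
rewrite {1}[z]complexE (le_trans (ler_normD _ _))// rmorphD/= lerD//.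
  by rewrite normc_def /= expr0n addr0 sqrtr_sqr.
rewrite normrM (_ : `|'i| = 1) ?mul1r; last first.
  by rewrite normc_def /= expr0n expr1n add0r sqrtr1.
by rewrite normc_def /= expr0n addr0 sqrtr_sqr.
Qed.

Lemma borel_fun_open {F : topologicalType} (f : E -> F) :
  (forall A, open A -> borel_set (f @^-1` A)) -> borel_fun f.
Proof.
move=> of_; apply: smallest_sub; last exact: of_.
have [h0 hD hU] := smallest_sigma_algebra [set: E] open.
split => [|A /hD|A /hU]; rewrite /borel_set /=.
- by rewrite preimage_set0.
- by rewrite !setTD.
- by rewrite preimage_bigcup.
Qed.

Lemma continuous_borel {F : topologicalType} (f : E -> F) :
  continuous f -> borel_fun f.
Proof.
move=> /continuousP cf; apply: borel_fun_open => A oA.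
by apply: sub_sigma_algebra; exact: cf.
Qed.

Lemma borel_fun_comp_measurable x f (g : R[i]^o -> R) : borel_fun f ->
  continuous (g : R[i]^o -> R^o) ->
  measurable_fun [set: borel_space x] (g \o f : borel_space x -> R).
Proof.
move=> bf /continuousP cg; apply: (measurability _ (RGenOpens.measurableE R)).
move=> _ [_ [a [b ->] <-]]; rewrite setTI comp_preimage.
apply: bf; apply: sub_sigma_algebra; apply: cg; exact: interval_open.
Qed.

Lemma borel_ReImP x f :
  borel_fun f <->
  measurable_fun [set: borel_space x]
    ((fun y => complex.Re (f y)) : borel_space x -> R) /\
  measurable_fun [set: borel_space x]
    ((fun y => complex.Im (f y)) : borel_space x -> R).
Proof.
split=> [bf|[mr mi]].
  split.
    exact: (@borel_fun_comp_measurable x f _ bf continuous_Re).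
  exact: (@borel_fun_comp_measurable x f _ bf continuous_Im).
apply: borel_fun_open => O oO.
pose box (a b c d : rat) : set R[i]^o := [set z |
  `](ratr a : R), ratr b[%classic (complex.Re z) /\
  `](ratr c : R), ratr d[%classic (complex.Im z)].
suff -> : f @^-1` O = \bigcup_(a : rat) \bigcup_(b : rat) \bigcup_(c : rat)
    \bigcup_(d : rat) (if `[< box a b c d `<=` O >] then
      f @^-1` (box a b c d) else set0).
  change (measurable (\bigcup_a \bigcup_b \bigcup_c \bigcup_d
    (if `[< box a b c d `<=` O >] then
      f @^-1` (box a b c d) else set0) : set (borel_space x))).
  do 4 (apply: bigcupT_measurable_rat => ?).
  case: ifP => _ //; apply: measurableI.
    by rewrite -[X in measurable X]setTI; apply: mr.
  by rewrite -[X in measurable X]setTI; apply: mi.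
apply/seteqP; split => y /=; last first.
  by move=> [a _ [b _ [c _ [d _]]]]; case: ifPn => [/asboolP + fy|//]; exact.
move=> Oy.
have /nbhs_ballP[e /= e0 eO] : nbhs (f y) O by exact: open_nbhs_nbhs.
have [r r0 re] : exists2 r : R, 0 < r & r%:C = e.
  case: e e0 {eO} => a b; rewrite ltcE/= => /andP[/eqP b0 a0].
  by exists a => //; rewrite b0.
have r2 : 0 < r / 2 by rewrite divr_gt0.
have lt1 (t : R) : t - r / 2 < t by rewrite ltrBlDr ltrDl.
have lt2 (t : R) : t < t + r / 2 by rewrite ltrDl.
have [a /itvP ha] := rat_in_itvoo (lt1 (complex.Re (f y))).
have [b /itvP hb] := rat_in_itvoo (lt2 (complex.Re (f y))).
have [c /itvP hc] := rat_in_itvoo (lt1 (complex.Im (f y))).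
have [d /itvP hd] := rat_in_itvoo (lt2 (complex.Im (f y))).
exists a => //; exists b => //; exists c => //; exists d => //.
rewrite ifT; first by rewrite /box /= !in_itv/= !(ha, hb, hc, hd).
apply/asboolP => w [/=]; rewrite !in_itv/= => /andP[w1 w2] /andP[w3 w4].
apply: eO; rewrite -re -ball_normE /=.
apply: (le_lt_trans (norm_le_ReIm _)); rewrite ltcR.
have -> : complex.Re (f y - w) = complex.Re (f y) - complex.Re w.
  by case: (f y) w {w1 w2 w3 w4} => [? ?] [? ?].
have -> : complex.Im (f y - w) = complex.Im (f y) - complex.Im w.
  by case: (f y) w {w1 w2 w3 w4} => [? ?] [? ?].
rewrite [ltRHS]splitr ltrD// ltr_distlC.
  rewrite (lt_trans _ w1) ?ha//= (lt_trans w2)// hb//.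
by rewrite (lt_trans _ w3) ?hc//= (lt_trans w4)// hd.
Qed.

Lemma borel_fun_linear (a : R[i]) f g :
  borel_fun f -> borel_fun g -> borel_fun (a *: f + g).
Proof.
move=> bf bg; have [[x _]|E0] := pselect (exists x : E, True); last first.
  move=> B _; rewrite (_ : _ @^-1` B = set0).
    by have [] := smallest_sigma_algebra [set: E] open.
  by rewrite -subset0 => x; exfalso; apply: E0; exists x.
have [fr fi] := (borel_ReImP x f).1 bf; have [gr gi] := (borel_ReImP x g).1 bg.
apply/(borel_ReImP x); split.
  rewrite (_ : (fun y => _) = (fun y => (complex.Re a * complex.Re (f y) -
      complex.Im a * complex.Im (f y)) + complex.Re (g y))); last first.
    apply/funext => y; rewrite /GRing.add /GRing.scale /=.
    by case: a (f y) (g y) => [? ?] [? ?] [? ?].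
  by apply: measurable_funD => //; apply: measurable_funB;
    apply: measurable_funM.
rewrite (_ : (fun y => _) = (fun y => (complex.Re a * complex.Im (f y) +
    complex.Im a * complex.Re (f y)) + complex.Im (g y))); last first.
  apply/funext => y; rewrite /GRing.add /GRing.scale /=.
  by case: a (f y) (g y) => [? ?] [? ?] [? ?].
by apply: measurable_funD => //; apply: measurable_funD;
  apply: measurable_funM.
Qed.

Lemma bounded_fun_normP f :
  bounded_fun f <-> exists M : R, forall y, `|f y| <= M%:C.
Proof.
split=> [[M [Mr Mf]]|[M Mf]].
  exists (complex.Re M + 1) => y; apply: Mf => //.
  case: M Mr => a b; rewrite realE !lecE /= orbC eq_sym; case: eqP => // -> _.
  by rewrite ltcR ltrDl.
exists M%:C; split; first by rewrite realE !lecR -realE num_real.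
by move=> N /ltW MN y _; exact: le_trans (Mf y) MN.
Qed.

End complex_borel.

Section Mb.
Context (R : realType) (E : topologicalType).

Definition Mb_pred : {pred E -> R[i]^o} :=
  mem [set f | borel_fun f /\ bounded_fun f].

Record Mb := MkMb { Mb_fun :> E -> R[i]^o ; MbP : Mb_fun \in Mb_pred }.

HB.instance Definition _ := [isSub for Mb_fun].
HB.instance Definition _ := [Choice of Mb by <:].

Lemma Mb_submod_closed : submod_closed Mb_pred.
Proof.
split=> [|a f g].
  rewrite inE; split.
    by apply: continuous_borel => x; exact: cvg_cst.
  by apply/bounded_fun_normP; exists 0 => y; rewrite normr0.
rewrite !inE => -[bf /bounded_fun_normP[M Mf]] [bg /bounded_fun_normP[N Ng]].
split; first exact: borel_fun_linear.
apply/bounded_fun_normP; exists (complex.Re `|a| * M + N) => y.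
rewrite rmorphD rmorphM/=; apply: (le_trans (ler_normD _ _)).
by rewrite lerD// normrM (_ : (complex.Re `|a|)%:C = `|a|) // ler_wpM2l.
Qed.

HB.instance Definition _ := GRing.isSubmodClosed.Build _ _ Mb_pred
  Mb_submod_closed.
HB.instance Definition _ := [SubChoice_isSubLmodule of Mb by <:].

Definition Cb : set Mb := [set f | continuous (f : E -> R[i]^o)].

End Mb.

Definition Cintegral {R : realType} {d} {T : measurableType d}
    (mu : {measure set T -> \bar R}) (f : T -> R[i]) : R[i] :=
  (\int[mu]_t complex.Re (f t)) +i* (\int[mu]_t complex.Im (f t)).

Section operators.
Context {R : realType} {E : topologicalType}.
Implicit Type Phi : {linear Mb R E -> Mb R E}.

Definition markov_operator Phi : Prop :=
  forall x : E, exists mu : probability (borel_space x) R,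
    forall f : Mb R E, Phi f x = Cintegral mu f.

Definition strong_feller Phi : Prop := forall f : Mb R E, Cb (Phi f).

End operators.

Section restriction.
Context {R : realType} {K : topologicalType} (cK : compact [set: K]).
Variable U : set K.
Implicit Type h : continuousType K R[i]^o.

Lemma restr_in_Mb h : (h \o \val : set_type U -> R[i]^o) \in @Mb_pred R U.
Proof.
have bnd (g : R[i]^o -> R) : continuous (g : R[i]^o -> R^o) ->
    exists M, forall x, `|g (h x)| <= M.
  move=> cg; have : compact ((g \o h) @` [set: K]).
    apply: continuous_compact => //; apply: continuous_subspaceT => x.
    by apply: continuous_comp; [exact: cts_fun|exact: cg].
  move=> /compact_bounded[M [_ MP]]; exists (M + 1) => x.
  by apply: (MP (M + 1)); [rewrite ltrDl|exists x].
rewrite inE; split.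
  apply: continuous_borel => x; apply: continuous_comp; last exact: cts_fun.
  exact: initial_continuous.
have [M Mh] := bnd _ continuous_Re; have [N Nh] := bnd _ continuous_Im.
apply/bounded_fun_normP; exists (M + N) => y.
by apply: le_trans (norm_le_ReIm _) _; rewrite lecR lerD// ?Mh ?Nh.
Qed.

(* h_U, for h in C(K); compactness of K is what puts it in M_b(U) *)
Definition restr h : Mb R (set_type U) := MkMb (restr_in_Mb h).

End restriction.

(* Main.v *)
Require Import Defs.
From mathcomp Require Import all_boot all_order all_algebra.
From mathcomp Require Import complex.
From mathcomp Require Import all_classical all_reals all_analysis.
From mathcomp Require Import measurable_realfun lra.
Import Order.TTheory GRing.Theory Num.Theory.
Import numFieldNormedType.Exports.

Set Implicit Arguments.
Unset Strict Implicit.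
Unset Printing Implicit Defensive.

Local Open Scope classical_set_scope.
Local Open Scope ring_scope.

(** Let P g x be the integral of a bounded Borel function g on U against the
    probability measure attached to x, so that Phi is P acting separately on
    real and imaginary parts. The proof is carried out for P and real-valued
    functions, with the vocabulary of potential theory: a continuous function
    on K is superharmonic, subharmonic or harmonic according to whether P
    decreases, increases or fixes its restriction to U.

    Boundary behaviour. The functions given by condition A are subharmonic
    barriers. If F is continuous on K and x is a boundary point with barrier h,
    then for every e > 0 some C >= 0 gives F x - e + C h <= F <= F x + e - C h
    on K (barrier_bound). Say that g is trapped by F when g lies between all
    subharmonic minorants and superharmonic majorants of F. Being trapped is
    preserved by P, by tail suprema and by pointwise limits, and
    trapped_near_boundary shows that all functions trapped by F tend to F at
    the boundary, at a common rate. Hence a continuous function on U trapped by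
    F extends to K continuously by F.

    Existence. Put u_n = P^n F and q = limsup u_n. Since P preserves order and
    bounded limits, q <= P q, so P^n q increases to a function g with P g = g.
    The strong Feller property makes g continuous although q is merely Borel,
    and g is trapped by F, so g extends to a harmonic function on K equal to F
    on the boundary, and limsup u_n <= g (harmonic_majorant). The same
    construction for - F gives a harmonic g' with liminf u_n >= - g'. Condition
    B yields the maximum principle, hence uniqueness of harmonic functions with
    given boundary values, so g = - g' and u_n converges to g pointwise.

    Uniformity. One more application of P turns bounded pointwise convergence
    into locally uniform convergence: if r_n is the supremum of |u_m - g| over
    m >= n, then P r_n is continuous, decreases to 0 and dominates
    |u_(m+1) - g| for m >= n (feller_locally_uniform). Near the boundary the
    trapping estimate is uniform in n, and compactness of K combines the two.

    For the complex statement, the boundary function is first extended to K by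
    Tietze's theorem, and the real result is applied to both parts. *)

(** * Bounded Borel functions and their averages *)

Section bounded_borel.
Context {R : realType} {E : topologicalType}.
Implicit Types f g : E -> R.

Definition bounded_borel g : Prop :=
  borel_fun (g : E -> R^o) /\ exists M, forall y, `|g y| <= M.

Lemma borel_measurableP (x : E) g :
  borel_fun (g : E -> R^o) <->
  measurable_fun [set: borel_space x] (g : borel_space x -> R).
Proof.
split=> [bg|mg].
  apply: (measurability _ (RGenOpens.measurableE R)).
  move=> _ [_ [a [b ->] <-]]; rewrite setTI.
  by apply: bg; apply: sub_sigma_algebra; exact: interval_open.
apply: borel_fun_open => A oA.
rewrite -[X in borel_set X]setTI.
by apply: (mg measurableT); exact: open_measurable.
Qed.

(** Measurable types carry a point, so measurability lemmas can be invoked only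
    after choosing one; on an empty space every function is Borel. *)
Lemma borel_fun_inhabited {F : topologicalType} (f : E -> F) :
  (E -> borel_fun f) -> borel_fun f.
Proof.
have [[x _] /(_ x)//|E0 _ B _] := pselect (exists x : E, True).
rewrite (_ : _ @^-1` B = set0); last first.
  by rewrite -subset0 => x; exfalso; apply: E0; exists x.
by have [] := smallest_sigma_algebra [set: E] open.
Qed.

Lemma bounded_borel_linear a f g : bounded_borel f -> bounded_borel g ->
  bounded_borel (fun y => a * f y + g y).
Proof.
move=> [bf [M fM]] [bg [N gN]]; split.
  apply: borel_fun_inhabited => x; apply: (borel_measurableP x _).2.
  apply: measurable_funD; last exact: (borel_measurableP x _).1.
  by apply: measurable_funM => //; exact: (borel_measurableP x _).1.
exists (`|a| * M + N) => y.
by rewrite (le_trans (ler_normD _ _))// lerD// normrM ler_wpM2l.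
Qed.

Lemma bounded_borel_cst c : bounded_borel (fun _ : E => c).
Proof.
split; last by exists `|c|.
by apply: continuous_borel => x; exact: cvg_cst.
Qed.

Lemma bounded_borel_affine a b g :
  bounded_borel g -> bounded_borel (fun y => a + b * g y).
Proof.
move=> bg; have := bounded_borel_linear b bg (bounded_borel_cst a).
by congr bounded_borel; apply/funext => y; rewrite addrC.
Qed.

Lemma bounded_borelN g : bounded_borel g -> bounded_borel (fun y => - g y).
Proof.
move=> /(bounded_borel_affine 0 (-1)).
by congr bounded_borel; apply/funext => y; rewrite add0r mulN1r.
Qed.

Lemma bounded_borelD f g : bounded_borel f -> bounded_borel g ->
  bounded_borel (fun y => f y + g y).
Proof.
move=> bf bg; have := bounded_borel_linear 1 bf bg.
by congr bounded_borel; apply/funext => y; rewrite mul1r.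
Qed.

Lemma bounded_borel_cvg (g_ : nat -> E -> R) g M :
  (forall n, borel_fun (g_ n : E -> R^o)) -> (forall n y, `|g_ n y| <= M) ->
  (forall y, g_ n y @[n --> \oo] --> g y) -> bounded_borel g.
Proof.
move=> bg gM gg; split.
  apply: borel_fun_inhabited => x; apply: (borel_measurableP x _).2.
  apply: (@measurable_fun_cvg _ _ _ _
    (fun n => g_ n : borel_space x -> R)) => [n|y _]; last exact: gg.
  exact: (borel_measurableP x _).1.
exists M => y; have /cvg_norm ng := gg y.
by apply: (cvgr_to_le ng); exact: nearW.
Qed.

End bounded_borel.

Lemma Rintegral_probability_cst {R : realType} d (T : measurableType d)
  (P : probability T R) (r : R) : \int[P]_t r = r.
Proof.
rewrite Rintegral_cst// (_ : fine _ = 1) ?mulr1//.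
by transitivity (fine (P setT)) => //; rewrite probability_setT.
Qed.

Section averages.
Context {R : realType} {E : topologicalType}.
Variable mu : forall x : E, probability (borel_space x) R.
Implicit Types f g : E -> R.

Definition average g (x : E) : R := \int[mu x]_t g t.

Lemma bounded_borel_integrable x g : bounded_borel g ->
  (mu x).-integrable setT (EFin \o (g : borel_space x -> R)).
Proof.
move=> [/(borel_measurableP x) mg [M gM]].
apply: measurable_bounded_integrable => //.
  exact: le_lt_trans (probability_le1 _ measurableT) (ltry 1).
exists M; split=> [|N MN y _]; first exact: num_real.
exact: le_trans (gM y) (ltW MN).
Qed.

Lemma average_linear a f g x : bounded_borel f -> bounded_borel g ->
  average (fun y => a * f y + g y) x = a * average f x + average g x.
Proof.
move=> bf bg; rewrite /average.
rewrite (@RintegralD _ _ _ (mu x) setT (fun y : borel_space x => a * f y) g)//.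
- by rewrite RintegralZl//; exact: bounded_borel_integrable.
- have := bounded_borel_linear a bf (bounded_borel_cst 0).
  rewrite (_ : (fun y => _) = (fun y => a * f y)); last first.
    by apply/funext => y; rewrite addr0.
  exact: bounded_borel_integrable.
- exact: bounded_borel_integrable.
Qed.

Lemma average_le f g x : bounded_borel f -> bounded_borel g ->
  (forall y, f y <= g y) -> average f x <= average g x.
Proof.
move=> bf bg fg; apply: le_Rintegral => //; exact: bounded_borel_integrable.
Qed.

Lemma average_cvg (g_ : nat -> E -> R) g M x :
  (forall n, borel_fun (g_ n : E -> R^o)) -> (forall n y, `|g_ n y| <= M) ->
  (forall y, g_ n y @[n --> \oo] --> g y) ->
  average (g_ n) x @[n --> \oo] --> average g x.
Proof.
move=> bg gM gg; apply: fine_cvg; rewrite fineK; last first.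
  apply: integrable_fin_num => //.
  exact: bounded_borel_integrable (bounded_borel_cvg bg gM gg).
apply: (@dominated_cvg _ _ _ (mu x) setT measurableT
  (fun n => EFin \o (g_ n : borel_space x -> R)) _ (cst M%:E)) => //.
- by move=> n; apply/measurable_EFinP; exact: (borel_measurableP x _).1.
- by move=> y _; apply: cvg_EFin; [exact: nearW|exact: gg].
- exact: finite_measure_integrable_cst.
- by move=> n y _; rewrite lee_fin.
Qed.

End averages.

Section feller_average.
Context {R : realType} {E : topologicalType}.
Implicit Types (f g : E -> R) (P : (E -> R) -> E -> R).

(** The real counterpart of a strong Feller Markov operator. It hides the
    measures: each of them lives on a measurable type that depends on the point
    it is attached to, so that they do not form a family over a single type. *)
Record feller_average P : Prop := FellerAverage {
  feller_le : forall f g, bounded_borel f -> bounded_borel g ->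
    (forall y, f y <= g y) -> forall x, P f x <= P g x ;
  feller_cst : forall c x, P (fun=> c) x = c ;
  feller_linear : forall a f g x, bounded_borel f -> bounded_borel g ->
    P (fun y => a * f y + g y) x = a * P f x + P g x ;
  feller_cvg : forall (g_ : nat -> E -> R) g M x,
    (forall n, borel_fun (g_ n : E -> R^o)) -> (forall n y, `|g_ n y| <= M) ->
    (forall y, g_ n y @[n --> \oo] --> g y) ->
    P (g_ n) x @[n --> \oo] --> P g x ;
  feller_continuous : forall g, bounded_borel g -> continuous (P g) }.

Lemma real_complex_in_Mb g : bounded_borel g ->
  (fun y => (g y)%:C%C : R[i]^o) \in @Mb_pred R E.
Proof.
move=> [bg [M gM]]; rewrite inE; split.
  apply: borel_fun_inhabited => x.
  apply: (borel_ReImP x _).2; split; first exact: (borel_measurableP x _).1.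
  exact: measurable_cst.
apply/bounded_fun_normP; exists M => y.
by rewrite normc_def /= expr0n addr0 sqrtr_sqr lecR.
Qed.

(** Integrating against real measures treats real and imaginary parts
    separately, so Phi is determined by one real averaging operator. *)
Lemma strong_feller_average (Phi : {linear Mb R E -> Mb R E}) :
  markov_operator Phi -> strong_feller Phi ->
  exists2 P, feller_average P & forall (f : Mb R E) x,
    complex.Re (Phi f x) = P (fun y => complex.Re (f y)) x /\
    complex.Im (Phi f x) = P (fun y => complex.Im (f y)) x.
Proof.
move=> mk sf; pose mu x := projT1 (cid (mk x)).
have Phimu (f : Mb R E) x : Phi f x = Cintegral (mu x) f.
  exact: projT2 (cid (mk x)) f.
exists (average mu); last by move=> f x; rewrite Phimu.
split.
- by move=> f g bf bg fg x; exact: average_le.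
- by move=> c x; exact: Rintegral_probability_cst.
- by move=> a f g x bf bg; exact: average_linear.
- by move=> g_ g M x; exact: average_cvg.
- move=> g bg x.
  pose f : Mb R E := MkMb (real_complex_in_Mb bg).
  have -> : average mu g = fun x => complex.Re (Phi f x).
    by apply/funext => y; rewrite Phimu.
  by apply: continuous_comp; [exact: sf|exact: continuous_Re].
Qed.

End feller_average.

Section feller_average_theory.
Context {R : realType} {E : topologicalType}.
Variable P : (E -> R) -> E -> R.
Hypothesis avP : feller_average P.
Implicit Types f g : E -> R.

Lemma feller_affine a b g x : bounded_borel g ->
  P (fun y => a + b * g y) x = a + b * P g x.
Proof.
move=> bg; rewrite -[in RHS](feller_cst avP a x) [RHS]addrC.
rewrite -(feller_linear avP)//; last exact: bounded_borel_cst.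
by congr (P _ x); apply/funext => y; rewrite addrC.
Qed.

Lemma fellerN g x : bounded_borel g -> P (fun y => - g y) x = - P g x.
Proof.
move=> /(feller_affine 0 (-1) x); rewrite add0r mulN1r => <-.
by congr (P _ x); apply/funext => y; rewrite add0r mulN1r.
Qed.

Lemma fellerD f g x : bounded_borel f -> bounded_borel g ->
  P (fun y => f y + g y) x = P f x + P g x.
Proof.
move=> bf bg; rewrite -[P f x]mul1r -(feller_linear avP)//.
by congr (P _ x); apply/funext => y; rewrite mul1r.
Qed.

Lemma bounded_borel_feller g : bounded_borel g -> bounded_borel (P g).
Proof.
move=> bg; split.
  by apply: continuous_borel; exact: (feller_continuous avP bg).
have [_ [M gM]] := bg; exists M => y; rewrite ler_norml.
apply/andP; split.
  rewrite -(feller_cst avP (- M) y); apply: (feller_le avP) => //.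
    exact: bounded_borel_cst.
  by move=> z; have := gM z; rewrite ler_norml => /andP[].
rewrite -[leRHS](feller_cst avP M y); apply: (feller_le avP) => //.
  exact: bounded_borel_cst.
by move=> z; have := gM z; rewrite ler_norml => /andP[].
Qed.

Lemma bounded_borel_iter n g : bounded_borel g -> bounded_borel (iter n P g).
Proof. by move=> bg; elim: n => //= n; exact: bounded_borel_feller. Qed.

Lemma iter_fellerN n g : bounded_borel g ->
  iter n P (fun y => - g y) = fun y => - iter n P g y.
Proof.
move=> bg; elim: n => //= n ->; apply/funext => y.
by rewrite fellerN//; exact: bounded_borel_iter.
Qed.

Lemma feller_dist f g r : bounded_borel f -> bounded_borel g ->
  bounded_borel r -> (forall y, `|f y - g y| <= r y) ->
  forall x, `|P f x - P g x| <= P r x.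
Proof.
move=> bf bg br fgr x; rewrite ler_distl lerBlDr.
rewrite -!fellerD//; apply/andP; split; apply: (feller_le avP) => //;
  try exact: bounded_borelD;
  by move=> y; have := fgr y; rewrite ler_distl lerBlDr => /andP[].
Qed.

End feller_average_theory.

(** * Functions trapped between sub- and superharmonic functions *)

(** Where F differs from F x by less than e any C >= 0 works, since h <= 0. The
    rest of K is compact and avoids x, so h is bounded away from 0 there and a
    large C absorbs the oscillation of F. *)
Lemma barrier_bound {R : realType} {K : topologicalType}
    (cK : compact [set: K]) (F h : K -> R) x (e : R) :
  continuous F -> continuous h -> h x = 0 -> (forall y, y <> x -> h y < 0) ->
  0 < e -> exists2 C, 0 <= C & forall y, `|F y - F x| <= e - C * h y.
Proof.
move=> cF ch hx h0 e0; pose D y := `|F y - F x|.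
have cD : continuous D.
  move=> y; apply: cvg_norm; apply: cvgB; [exact: cF|exact: cvg_cst].
have h_le0 y : h y <= 0.
  by have [->|/eqP/h0/ltW//] := eqVneq y x; rewrite hx.
pose A := [set y | e <= D y].
have [A0|/set0P A0] := eqVneq A set0.
  exists 0 => // y; rewrite mul0r subr0 leNgt; apply/negP => /ltW ey.
  by have : A y by []; rewrite A0.
have cA : compact A.
  apply: subclosed_compact cK _ => //.
  by apply: (@closed_comp _ _ D [set r | e <= r]) => //; exact: closed_ge.
have [c] := compact_EVT_max A0 cA (continuous_subspaceT ch).
rewrite inE => Ac hc.
have [|m _ Dm] := compact_EVT_max _ cK (continuous_subspaceT cD).
  by exists x.
have hc0 : h c < 0.
  apply: h0 => cx; have : e <= D c by [].
  by rewrite /D cx subrr normr0 leNgt e0.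
have Dm0 : 0 <= D m / - h c.
  by rewrite divr_ge0 ?oppr_ge0 ?(ltW hc0)//; exact: normr_ge0.
(* D m is the maximum of D, and - h c the distance of h from 0 on A. *)
exists (D m / - h c) => // y; have [ey|ey] := leP e (D y); last first.
  by rewrite (le_trans (ltW ey))// lerDl oppr_ge0 mulr_ge0_le0.
apply: (le_trans (Dm y _)); first by rewrite inE.
rewrite -mulrN; apply: ler_wpDl; first exact: ltW.
apply: (@le_trans _ _ (D m / - h c * - h c)).
  by rewrite divfK// oppr_eq0 lt_eqF.
by rewrite ler_wpM2l// lerN2 hc ?inE.
Qed.

Section trapping.
Context {R : realType} {K : topologicalType}.
Hypothesis cK : compact [set: K].
Variable U : set K.
Variable P : (U -> R) -> U -> R.
Hypothesis avP : feller_average P.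
Implicit Types (F a b h : K -> R) (g : U -> R).

Local Notation on_U F := (fun u : U => F (\val u)).

Definition superharmonic a :=
  continuous a /\ forall u : U, P (on_U a) u <= a (\val u).

Definition subharmonic b :=
  continuous b /\ forall u : U, b (\val u) <= P (on_U b) u.

Definition has_barrier x := exists2 h, subharmonic h &
  h x = 0 /\ forall y, y <> x -> h y < 0.

(** Quantifying over all minorants and majorants makes stability under P, tail
    suprema and limits immediate, with no estimate to propagate: the barriers
    enter only when boundary values are read off. *)
Definition trapped F g :=
  (forall a, superharmonic a -> (forall y, F y <= a y) ->
     forall u : U, g u <= a (\val u)) /\
  (forall b, subharmonic b -> (forall y, b y <= F y) ->
     forall u : U, b (\val u) <= g u).

Lemma continuous_bounded F : continuous F -> exists M, forall y, `|F y| <= M.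
Proof.
move=> cF; have : compact (F @` [set: K]).
  by apply: continuous_compact => //; exact: continuous_subspaceT.
move=> /compact_bounded[M [_ MP]]; exists (M + 1) => x.
by apply: (MP (M + 1)); [rewrite ltrDl|exists x].
Qed.

Lemma continuous_on_U F : continuous F -> continuous (on_U F).
Proof.
by move=> cF u; apply: continuous_comp; [exact: initial_continuous|exact: cF].
Qed.

Lemma bounded_borel_on_U F : continuous F -> bounded_borel (on_U F).
Proof.
move=> cF; split; first by apply: continuous_borel; exact: continuous_on_U.
by have [M FM] := continuous_bounded cF; exists M.
Qed.

Lemma trapped_self F : trapped F (on_U F).
Proof. by split. Qed.

Lemma trapped_feller F g : bounded_borel g -> trapped F g -> trapped F (P g).
Proof.
move=> bg [gle gge]; split=> [a [ca sa]|b [cb sb]] Fa u.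
  apply: le_trans (sa u); apply: (feller_le avP) => //.
    exact: bounded_borel_on_U.
  exact: gle.
apply: le_trans (sb u) _; apply: (feller_le avP) => //.
  exact: bounded_borel_on_U.
exact: gge.
Qed.

Lemma trapped_iter F g n :
  bounded_borel g -> trapped F g -> trapped F (iter n P g).
Proof.
move=> bg Fg; elim: n => //= n; apply: trapped_feller.
exact: bounded_borel_iter.
Qed.

Lemma trapped_cvg F (g_ : nat -> U -> R) g :
  (forall n, trapped F (g_ n)) -> (forall u, g_ n u @[n --> \oo] --> g u) ->
  trapped F g.
Proof.
move=> Fg gg; split=> [a sa Fa|b sb bF] u.
- apply: (cvgr_to_le (gg u)); apply: nearW => n.
  by have [gle _] := Fg n; exact: gle.
- apply: (cvgr_to_ge (gg u)); apply: nearW => n.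
  by have [_ gge] := Fg n; exact: gge.
Qed.

Lemma subharmonic_affine (c C : R) h :
  0 <= C -> subharmonic h -> subharmonic (fun y => c + C * h y).
Proof.
move=> C0 [ch sh]; split=> [y|u].
  by apply: cvgD; [exact: cvg_cst|apply: cvgM; [exact: cvg_cst|exact: ch]].
rewrite (feller_affine avP); last exact: bounded_borel_on_U.
by rewrite lerD2l ler_wpM2l.
Qed.

Lemma superharmonic_affine (c C : R) h :
  0 <= C -> subharmonic h -> superharmonic (fun y => c - C * h y).
Proof.
move=> C0 [ch sh]; split=> [y|u].
  by apply: cvgB; [exact: cvg_cst|apply: cvgM; [exact: cvg_cst|exact: ch]].
have -> : (fun v : U => c - C * h (\val v)) = fun v => c + (- C) * h (\val v).
  by apply/funext => v; rewrite mulNr.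
rewrite (feller_affine avP); last exact: bounded_borel_on_U.
by rewrite mulNr lerD2l lerN2 ler_wpM2l.
Qed.

Lemma trapped_bounded F :
  continuous F -> exists M, forall g, trapped F g -> forall u, `|g u| <= M.
Proof.
move=> /continuous_bounded[M FM]; exists M => g [gle gge] u.
rewrite ler_norml; apply/andP; split.
- apply: (gge (fun=> - M)) => [|y].
    split; first by move=> y; exact: cvg_cst.
    by move=> v; rewrite (feller_cst avP).
  by have := FM y; rewrite ler_norml => /andP[].
- apply: (gle (fun=> M)) => [|y].
    split; first by move=> y; exact: cvg_cst.
    by move=> v; rewrite (feller_cst avP).
  by have := FM y; rewrite ler_norml => /andP[].
Qed.

(** The neighbourhood depends on F, x and e but not on the trapped function: this
    is what makes the convergence of the iterates uniform near the boundary. *)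
Lemma trapped_near_boundary F x (e : R) :
  continuous F -> has_barrier x -> 0 < e -> \forall y \near x,
    `|F y - F x| <= e /\
    forall u : U, \val u = y -> forall g, trapped F g -> `|g u - F x| <= e.
Proof.
move=> cF [h sh [hx h0]] e0.
have e2 : 0 < e / 2 by rewrite divr_gt0.
have [C C0 FC] := barrier_bound cK cF sh.1 hx h0 e2.
have : C * h y @[y --> x] --> C * h x.
  by apply: cvgM; [exact: cvg_cst|exact: sh.1].
rewrite hx mulr0 => /cvgr_dist_le/(_ _ e2).
apply: filterS => y; rewrite sub0r normrN ler_norml => /andP[hy _].
split=> [|u uy g [gle gge]].
  by have := FC y; lra.
have le_a : g u <= F x + e / 2 - C * h (\val u).
  apply: (gle (fun z => F x + e / 2 - C * h z)).
    exact: superharmonic_affine.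
  by move=> z; have := FC z; rewrite ler_norml => /andP[]; lra.
have le_b : F x - e / 2 + C * h (\val u) <= g u.
  apply: (gge (fun z => F x - e / 2 + C * h z)).
    exact: subharmonic_affine.
  by move=> z; have := FC z; rewrite ler_norml => /andP[]; lra.
by rewrite ler_norml; move: le_a le_b; rewrite uy; lra.
Qed.

End trapping.

(** * The Dirichlet problem: uniqueness *)

Lemma nbhs_set_type {K : topologicalType} (U : set K) (u : U) (A : set U) :
  nbhs u A -> \forall y \near \val u, forall v : U, \val v = y -> A v.
Proof.
move=> [_ [[W oW <-] /= Wu WA]].
have /filterS : nbhs (\val u) W by exact: open_nbhs_nbhs.
by apply=> y Wy v vy; apply: WA; rewrite -vy in Wy.
Qed.

Section pasting.
Context {R : realType} {K : topologicalType}.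
Variable U : set K.
Hypothesis U_open : open U.
Implicit Types (F : K -> R) (g : U -> R).

Definition paste F g (y : K) : R :=
  if pselect (U y) is left Uy then g (exist _ y (mem_set Uy)) else F y.

Lemma paste_in F g (u : U) : paste F g (\val u) = g u.
Proof.
rewrite /paste; case: pselect => [Uu|[]]; last exact: set_valP.
by congr g; apply: val_inj.
Qed.

Lemma paste_out F g y : ~ U y -> paste F g y = F y.
Proof. by rewrite /paste; case: pselect. Qed.

Lemma paste_continuous_in F g y : continuous g -> U y ->
  {for y, continuous (paste F g)}.
Proof.
move=> cg Uy.
suff : {within U, continuous (paste F g)}.
  by rewrite continuous_open_subspace// => /(_ y); apply; rewrite inE.
apply/subspace_sigL_continuousP.
rewrite (_ : sigL U (paste F g) = g)//.
by apply/funext => u; rewrite -[RHS](paste_in F).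
Qed.

End pasting.

Section dirichlet.
Context {R : realType} {K : topologicalType}.
Hypothesis cK : compact [set: K].
Variable U : set K.
Hypothesis U_open : open U.
Variable P : (U -> R) -> U -> R.
Hypothesis avP : feller_average P.
Hypothesis barrier : forall x, ~ U x -> has_barrier P x.
Hypothesis outside : exists x, ~ U x.
Hypothesis strong_max : forall g : K -> R, subharmonic P g ->
  (exists z, U z /\ forall x, g x <= g z) -> exists c, forall x, g x = c.
Implicit Types (F G : K -> R) (g : U -> R).

Local Notation on_U F := (fun u : U => F (\val u)).

Lemma paste_continuous F g : continuous F -> continuous g -> trapped P F g ->
  continuous (paste F g).
Proof.
move=> cF cg Fg x; have [Ux|Ux] := pselect (U x).
  exact: paste_continuous_in.
apply/cvgrPdist_le => e e0; rewrite paste_out//.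
apply: filterS (trapped_near_boundary cK avP cF (barrier Ux) e0).
move=> y [Fy gy]; rewrite distrC; have [Uy|Uy] := pselect (U y).
  by rewrite -[y]/(\val (exist _ y (mem_set Uy) : U)) paste_in; exact: gy.
by rewrite paste_out.
Qed.

(** At an interior maximum the strong maximum principle makes F constant, and
    the constant can be read off at a point outside U. *)
Lemma max_principle F : subharmonic P F -> (forall x, ~ U x -> F x <= 0) ->
  forall x, F x <= 0.
Proof.
move=> sF F0 x; have [x0 Ux0] := outside.
have [|z _ Fz] := compact_EVT_max _ cK (continuous_subspaceT sF.1).
  by exists x0.
have {}Fz y : F y <= F z by apply: Fz; rewrite inE.
have [Uz|Uz] := pselect (U z); last by rewrite (le_trans (Fz x))// F0.
have [|c Fc] := strong_max sF; first by exists z.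
by rewrite (Fc x) -(Fc x0) F0.
Qed.

Lemma harmonic_unique F G : continuous F -> continuous G ->
  (forall u, P (on_U F) u = F (\val u)) ->
  (forall u, P (on_U G) u = G (\val u)) ->
  (forall x, ~ U x -> F x = G x) -> F = G.
Proof.
move=> cF cG hF hG FG.
have le0 A B : continuous A -> continuous B ->
    (forall u, P (on_U A) u = A (\val u)) ->
    (forall u, P (on_U B) u = B (\val u)) ->
    (forall x, ~ U x -> A x = B x) -> forall x, A x <= B x.
  move=> cA cB hA hB AB x; rewrite -subr_le0.
  apply: (@max_principle (fun y => A y - B y)) => [|y Uy]; last first.
    by rewrite AB// subrr.
  split=> [y|u]; first by apply: cvgB; [exact: cA|exact: cB].
  rewrite (fellerD avP u (bounded_borel_on_U cK U cA)); last first.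
    exact/bounded_borelN/bounded_borel_on_U.
  by rewrite (fellerN avP) ?hA ?hB//; exact: bounded_borel_on_U.
apply/funext => x; apply/eqP; rewrite eq_le; apply/andP; split; apply: le0 => //.
by move=> y Uy; rewrite FG.
Qed.

End dirichlet.

(** * Convergence of the iterates *)

Section tail_suprema.
Context {R : realType}.
Implicit Types a : nat -> R.

Lemma le_sups a M n m : (forall k, a k <= M) -> (n <= m)%N -> a m <= sups a n.
Proof.
move=> aM nm; apply: ub_le_sup; last by exists m.
by exists M => _ [k _ <-].
Qed.

Lemma sups_le a M n : (forall k, (n <= k)%N -> a k <= M) -> sups a n <= M.
Proof.
move=> aM; apply: ge_sup; first by exists (a n), n => //=.
by move=> _ [k nk <-]; exact: aM.
Qed.

Lemma sups_bounded a M n : (forall k, `|a k| <= M) -> `|sups a n| <= M.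
Proof.
move=> aM; have aM' k : - M <= a k /\ a k <= M.
  by have := aM k; rewrite ler_norml => /andP[].
rewrite ler_norml; apply/andP; split; last by apply: sups_le => k _; apply aM'.
apply: le_trans (le_sups (M := M) _ (leqnn n)); first by apply aM'.
by move=> k; apply aM'.
Qed.

End tail_suprema.

Lemma bounded_borel_sups {R : realType} {E : topologicalType}
    (g_ : nat -> E -> R) M n :
  (forall k, borel_fun (g_ k : E -> R^o)) -> (forall k y, `|g_ k y| <= M) ->
  bounded_borel (fun y => sups (g_ ^~ y) n).
Proof.
move=> bg gM; split; last by exists M => y; exact: sups_bounded.
apply: borel_fun_inhabited => x; apply: (borel_measurableP x _).2.
apply: (@measurable_fun_sups _ _ _ _
  (fun k => g_ k : borel_space x -> R)) => [y _|k].
  by exists M => _ [k _ <-]; exact: le_trans (ler_norm _) (gM k y).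
exact: (borel_measurableP x _).1.
Qed.

(** The tail suprema r n of |f_ n - f| are merely Borel, but P makes them
    continuous: once P (r k) is small at x it is small near x, and it dominates
    the error after one more application of P for all n >= k. *)
Lemma feller_locally_uniform {R : realType} {E : topologicalType}
    (P : (E -> R) -> E -> R) (f_ : nat -> E -> R) (f : E -> R) (M e : R) (x : E) :
  feller_average P -> (forall n, bounded_borel (f_ n)) ->
  (forall n y, `|f_ n y| <= M) -> (forall y, f_ n y @[n --> \oo] --> f y) ->
  0 < e -> \forall y \near x & n \near \oo, `|P (f_ n) y - P f y| <= e.
Proof.
move=> avP bf_ f_M f_f e0.
have bf : bounded_borel f.
  by apply: (bounded_borel_cvg _ f_M f_f) => n; have [] := bf_ n.
have [_ [N fN]] := bf.
pose d n y := `|f_ n y - f y|.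
have dM n y : `|d n y| <= M + N.
  by rewrite normr_id (le_trans (ler_normB _ _))// lerD.
have bd n : borel_fun (d n : E -> R^o).
  apply: borel_fun_inhabited => z; apply: (borel_measurableP z _).2.
  apply: measurableT_comp => //; apply: measurable_funB.
    by apply: (borel_measurableP z _).1; have [] := bf_ n.
  by apply: (borel_measurableP z _).1; have [] := bf.
pose r n y := sups (d ^~ y) n.
have br n : bounded_borel (r n) by exact: (@bounded_borel_sups _ _ _ (M + N)).
have r0 y : r n y @[n --> \oo] --> (0 : R).
  apply: cvg_sups; rewrite -[X in _ --> X](@normr0 _ R); apply: cvg_norm.
  by rewrite -(subrr (f y)); apply: cvgB; [exact: f_f|exact: cvg_cst].
have rM n y : `|r n y| <= M + N by apply: sups_bounded.
have Pr0 : P (r n) x @[n --> \oo] --> (0 : R).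
  rewrite -[X in _ --> X](feller_cst avP 0 x).
  by apply: (feller_cvg avP _ rM r0) => n; have [] := br n.
have e2 : 0 < e / 2 by rewrite divr_gt0.
have /cvgr_dist_le/(_ _ e2)[k _ /(_ k (leqnn k)) /= Prk] := Pr0.
have /cvgr_dist_le/(_ _ e2) Prx : P (r k) y @[y --> x] --> P (r k) x.
  exact: (feller_continuous avP).
exists ([set y | `|P (r k) x - P (r k) y| <= e / 2], [set n | (k <= n)%N]).
  by split => //; exists k.
move=> [y n] [/= ry kn]; apply: (@le_trans _ _ (P (r k) y)).
  apply: (feller_dist avP) => // z.
  apply: (@le_sups _ (d ^~ z) (M + N)) => // m.
  exact: le_trans (ler_norm _) (dM m z).
by move: Prk ry; rewrite sub0r normrN !ler_norml => /andP[? ?] /andP[? ?]; lra.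
Qed.

Section convergence.
Context {R : realType} {K : topologicalType}.
Hypothesis cK : compact [set: K].
Variable U : set K.
Variable P : (U -> R) -> U -> R.
Hypothesis avP : feller_average P.
Implicit Types (F G : K -> R) (g : U -> R).

Local Notation on_U F := (fun u : U => F (\val u)).

Lemma trapped_sups F (g_ : nat -> U -> R) M n :
  (forall k, trapped P F (g_ k)) -> (forall k u, `|g_ k u| <= M) ->
  trapped P F (fun u => sups (g_ ^~ u) n).
Proof.
move=> Fg gM; split=> [a sa Fa|b sb bF] u.
  by apply: sups_le => k _; have [gle _] := Fg k; exact: gle.
have [_ gge] := Fg n; apply: le_trans (gge _ sb bF u) _.
apply: (@le_sups _ (g_ ^~ u) M) => // k; exact: le_trans (ler_norm _) (gM k u).
Qed.

(** The limit superior q of the iterates satisfies q <= P q, so that P^n q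
    increases to a fixed point of P. Working with q rather than with the
    iterates themselves provides monotonicity, hence a limit. *)
Lemma harmonic_majorant F : continuous F -> exists g,
  [/\ bounded_borel g, trapped P F g, P g = g & forall u (e : R), 0 < e ->
      \forall n \near \oo, iter n P (on_U F) u <= g u + e].
Proof.
move=> cF; have [M FM] := trapped_bounded cK avP cF.
pose u_ n := iter n P (on_U F).
have bF := bounded_borel_on_U cK U cF.
have bu n : bounded_borel (u_ n) by exact: bounded_borel_iter.
have tu n : trapped P F (u_ n).
  by apply: trapped_iter => //; exact: trapped_self.
have uM n v : `|u_ n v| <= M by exact: FM.
have uM' v n : u_ n v <= M by exact: le_trans (ler_norm _) (uM n v).
pose S n v := sups (u_ ^~ v) n.
have bS n : bounded_borel (S n).
  by apply: (@bounded_borel_sups _ _ _ M) => // k; have [] := bu k.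
have tS n : trapped P F (S n) by exact: (@trapped_sups _ _ M).
have SM n v : `|S n v| <= M by exact: FM.
pose q v := inf (range (S ^~ v)).
have Sq v : S n v @[n --> \oo] --> q v.
  apply: cvg_sups_inf; first by exists M => _ [k _ <-].
  exists (- M) => _ [k _ <-].
  by have := uM k v; rewrite ler_norml => /andP[].
have tq : trapped P F q by exact: trapped_cvg tS Sq.
have bq : bounded_borel q.
  by apply: (@bounded_borel_cvg _ _ S _ M) => // n; have [] := bS n.
(* S n dominates every u_ k with k >= n, so P (S n) dominates S n.+1. *)
have qPq v : q v <= P q v.
  have Sq1 : S n.+1 v @[n --> \oo] --> q v by have := Sq v; rewrite -cvg_shiftS.
  apply: (ler_cvg_to Sq1 (feller_cvg avP _ SM Sq)).
    by move=> n; have [] := bS n.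
  apply: nearW => n; apply: sups_le => -[//|k] nk.
  by apply: (feller_le avP) => // y; exact: (@le_sups _ (u_ ^~ y) M).
pose w n := iter n P q.
have bw n : bounded_borel (w n) by exact: bounded_borel_iter.
have tw n : trapped P F (w n) by exact: trapped_iter.
have wM n v : `|w n v| <= M by exact: FM.
have w_nd v : nondecreasing_seq (w ^~ v).
  apply/nondecreasing_seqP => n; elim: n v => [|n IHn] v; first exact: qPq.
  exact: (feller_le avP (bw n) (bw n.+1) IHn).
pose g v := sup (range (w ^~ v)).
have wg v : w n v @[n --> \oo] --> g v.
  apply: nondecreasing_cvgn; first exact: w_nd.
  by exists M => _ [k _ <-]; exact: le_trans (ler_norm _) (wM k v).
exists g; split.
- by apply: (@bounded_borel_cvg _ _ w _ M) => // n; have [] := bw n.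
- exact: trapped_cvg tw wg.
- apply/funext => v.
  have wPg : w n.+1 v @[n --> \oo] --> P g v.
    by apply: (feller_cvg avP _ wM wg) => n; have [] := bw n.
  have wg1 : w n.+1 v @[n --> \oo] --> g v by have := wg v; rewrite -cvg_shiftS.
  exact: (cvg_unique _ wPg wg1).
- move=> v e e0.
  have qg : q v <= g v.
    apply: ub_le_sup; last by exists 0%N.
    by exists M => _ [k _ <-]; exact: le_trans (ler_norm _) (wM k v).
  have /cvgr_dist_le/(_ _ e0) := Sq v; apply: filterS => n.
  rewrite ler_norml => /andP[Sn _].
  have := @le_sups _ (u_ ^~ v) M n n (uM' v) (leqnn n).
  rewrite -/(S n v) -/(u_ n v); lra.
Qed.

End convergence.

Section real_dirichlet.
Context {R : realType} {K : topologicalType}.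
Hypothesis cK : compact [set: K].
Variable U : set K.
Hypothesis U_open : open U.
Variable P : (U -> R) -> U -> R.
Hypothesis avP : feller_average P.
Hypothesis barrier : forall x, ~ U x -> has_barrier P x.
Hypothesis outside : exists x, ~ U x.
Hypothesis strong_max : forall g : K -> R, subharmonic P g ->
  (exists z, U z /\ forall x, g x <= g z) -> exists c, forall x, g x = c.
Implicit Types (F G : K -> R) (g : U -> R).

Local Notation on_U F := (fun u : U => F (\val u)).

(** Continuity of g comes for free: g is a value of P on a bounded Borel
    function. *)
Lemma harmonic_paste F g : continuous F -> bounded_borel g -> trapped P F g ->
  P g = g -> [/\ continuous (paste F g),
    forall u : U, P (on_U (paste F g)) u = paste F g (\val u) &
    forall x, ~ U x -> paste F g x = F x].
Proof.
move=> cF bg tg Pg; split.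
- apply: (paste_continuous cK U_open avP barrier cF _ tg).
  by rewrite -Pg; exact: (feller_continuous avP).
- move=> u; rewrite paste_in -[in RHS]Pg; congr (P _ u).
  by apply/funext => v; rewrite paste_in.
- by move=> x; exact: paste_out.
Qed.

(** The harmonic majorants of F and - F bound the iterates from above and from
    below in the limit; by uniqueness the two bounds coincide. *)
Lemma iter_pointwise_cvg F : continuous F -> exists g,
  [/\ bounded_borel g, trapped P F g, P g = g &
      forall u, iter n P (on_U F) u @[n --> \oo] --> g u].
Proof.
move=> cF; have cNF : continuous (fun y => - F y).
  by move=> y; apply: cvgN; exact: cF.
have bF := bounded_borel_on_U cK U cF.
have [g [bg tg Pg uleg]] := harmonic_majorant cK avP cF.
have [g' [bg' tg' Pg' g'leu]] := harmonic_majorant cK avP cNF.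
have [cG hG GF] := harmonic_paste cF bg tg Pg.
have [cG' hG' GF'] := harmonic_paste cNF bg' tg' Pg'.
have gg' u : - g' u = g u.
  rewrite -(paste_in F g u) -(paste_in (fun y => - F y) g' u).
  rewrite -(@harmonic_unique _ _ cK _ _ avP outside strong_max
    (fun y => - paste (fun y => - F y) g' y) (paste F g))// => [y|v|y Uy].
  - by apply: cvgN; exact: cG'.
  - by rewrite (fellerN avP) ?hG'//; exact: bounded_borel_on_U.
  - by rewrite GF// GF'// opprK.
exists g; split=> // u; apply/cvgrPdist_le => e e0.
apply: filterS2 (uleg u e e0) (g'leu u e e0) => n.
rewrite (iter_fellerN avP)// ler_norml -gg' => h1 h2; apply/andP; lra.
Qed.

Lemma real_dirichlet F : continuous F -> exists G,
  [/\ continuous G, forall u : U, P (on_U G) u = G (\val u),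
      forall x, ~ U x -> G x = F x &
      forall e : R, 0 < e -> \forall n \near \oo, forall u : U,
        `|iter n P (on_U F) u - G (\val u)| <= e].
Proof.
move=> cF; have [g [bg tg Pg ug]] := iter_pointwise_cvg cF.
have [cG hG GF] := harmonic_paste cF bg tg Pg.
exists (paste F g); split=> // e e0.
have [M FM] := trapped_bounded cK avP cF.
have bF := bounded_borel_on_U cK U cF.
have bu n : bounded_borel (iter n P (on_U F)) by exact: bounded_borel_iter.
have tu n : trapped P F (iter n P (on_U F)).
  by apply: trapped_iter => //; exact: trapped_self.
have uM n v : `|iter n P (on_U F) v| <= M by exact: FM.
(* The step from n to n.+1 is the application of P that gives local uniformity. *)
suff : \forall n \near \oo, [set: K] `<=` [set y | forall u : U, \val u = y ->
    `|iter n.+1 P (on_U F) u - g u| <= e].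
  case=> k _ Pk; exists k.+1 => // -[//|n] kn u; rewrite paste_in.
  by apply: (Pk n kn (\val u)).
apply: (compact_near_coveringP _).1 cK _ _ _ _ _ => x _.
have [Ux|Ux] := pselect (U x); last first.
  have e2 : 0 < e / 2 by rewrite divr_gt0.
  exists ([set y | forall u : U, \val u = y -> forall h, trapped P F h ->
    `|h u - F x| <= e / 2], setT).
    split=> /=; last exact: filterT.
    apply: filterS (trapped_near_boundary cK avP cF (barrier Ux) e2).
    by move=> y [].
  move=> [y n] [/= yF _] u uy.
  have := yF u uy _ (tu n.+1); have := yF u uy _ tg.
  by rewrite /= !ler_norml => /andP[? ?] /andP[? ?]; lra.
have [[A B] /= [Ax Boo] AB] :=
  feller_locally_uniform (exist _ x (mem_set Ux) : U) avP bu uM ug e0.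
exists ([set y | forall u : U, \val u = y -> A u], B).
  by split=> //; exact: nbhs_set_type Ax.
move=> [y n] [/= yA nB] u uy; rewrite -{1}Pg.
exact: (AB (u, n) (conj (yA u uy) nB)).
Qed.

End real_dirichlet.

(** * Complex-valued functions *)

Section complex_valued.
Context {R : realType}.

Lemma complex_gt0_ReP (e : R[i]) : 0 < e -> exists2 r : R, 0 < r & e = r%:C%C.
Proof.
case: e => a b; rewrite ltcE/= => /andP[/eqP b0 a0].
by exists a => //; rewrite b0.
Qed.

Lemma continuous_complex {T : topologicalType} (a b : T -> R) :
  continuous a -> continuous b ->
  continuous (fun x => (a x +i* b x)%C : R[i]^o).
Proof.
move=> ca cb x; apply/cvgrPdist_le => _ /complex_gt0_ReP[e e0 ->].
have e2 : 0 < e / 2 by rewrite divr_gt0.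
have /cvgr_dist_le/(_ _ e2) ax : a y @[y --> x] --> a x by exact: ca.
have /cvgr_dist_le/(_ _ e2) bx : b y @[y --> x] --> b x by exact: cb.
apply: filterS2 ax bx => y ay byy.
by rewrite (le_trans (norm_le_ReIm _))// lecR/= [leRHS]splitr lerD.
Qed.

Lemma uniform_cvg_complex {T : choiceType} (f_ : nat -> T -> R[i]^o)
    (f : T -> R[i]^o) :
  (forall e : R, 0 < e -> \forall n \near \oo, forall t,
     `|complex.Re (f_ n t) - complex.Re (f t)| <= e) ->
  (forall e : R, 0 < e -> \forall n \near \oo, forall t,
     `|complex.Im (f_ n t) - complex.Im (f t)| <= e) ->
  {uniform, f_ @ \oo --> f}.
Proof.
move=> fr fi A /uniform_nbhs[E [entE EA]].
have [_ /complex_gt0_ReP[e e0 ->] eE] : exists2 e : R[i], 0 < e &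
    [set xy : R[i]^o * R[i]^o | ball xy.1 e xy.2] `<=` E.
  by move: entE; rewrite -entourage_ballE => -[e /= e0 eE]; exists e.
have e3 : 0 < e / 3 by rewrite divr_gt0.
apply: filterS2 (fr _ e3) (fi _ e3) => n fnr fni; apply: EA => t _.
apply: eE; rewrite /= -ball_normE /=.
rewrite distrC (le_lt_trans (norm_le_ReIm _))// ltcR.
have := fnr t; have := fni t; case: (f_ n t) (f t) => [a b] [c d] /=; lra.
Qed.

End complex_valued.

(** Tietze's theorem for a function defined only on A: it is first extended by 0,
    which is continuous within A. *)
Lemma tietze_set_type {R : realType} {K : topologicalType} (A : set K)
    (f : A -> R) : normal_space K -> compact [set: K] -> closed A ->
  continuous f -> exists2 F : K -> R, continuous F & forall a, F (\val a) = f a.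
Proof.
move=> nK cK clA cf; pose f0 := paste (fun=> 0) f.
have cf0 : {within A, continuous f0}.
  apply/subspace_sigL_continuousP; rewrite (_ : sigL A f0 = f)//.
  by apply/funext => a; rewrite -[RHS](paste_in (fun=> 0)).
have [M [_ MP]] : bounded_set (f0 @` A).
  apply/compact_bounded/continuous_compact => //.
  exact: subclosed_compact cK _.
have [||F [fF cF _]] := continuous_bounded_extension nK clA (M := `|M| + 1) _ cf0.
- by rewrite ltr_wpDl.
- move=> x Ax; apply: (MP (`|M| + 1)); last by exists x.
  by rewrite (le_lt_trans (ler_norm M))// ltrDl.
- exists F => // a; rewrite -(fF (\val a)) ?/f0 ?paste_in//.
  exact/mem_set/set_valP.
Qed.

Lemma boundary_dense_open {K : topologicalType} (U : set K) :
  open U -> dense U -> boundary U = ~` U.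
Proof.
move=> oU dU; rewrite /boundary (interior_id U).1// setDE.
rewrite (_ : closure U = setT) ?setTI//; apply/seteqP; split=> // x _ B Bx.
have [||y [By Uy]] := dU B°; last first.
- by exists y; split=> //; exact: interior_subset By.
- exact: open_interior.
- by exists x.
Qed.

(** * From the real to the complex Dirichlet problem *)

Section reduction_to_real_parts.
Context {R : realType} {K : topologicalType}.
Hypothesis cK : compact [set: K].
Variable U : set K.
Variables (Phi : {linear Mb R U -> Mb R U}) (P : (U -> R) -> U -> R).
Hypothesis avP : feller_average P.
Hypothesis PhiP : forall (f : Mb R U) x,
  complex.Re (Phi f x) = P (fun y => complex.Re (f y)) x /\
  complex.Im (Phi f x) = P (fun y => complex.Im (f y)) x.
Implicit Types (F G h : continuousType K R[i]^o).

Local Notation on_U F := (fun u : U => F (\val u)).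

Lemma continuous_Re_comp h : continuous (fun y => complex.Re (h y)).
Proof.
by move=> y; apply: continuous_comp; [exact: cts_fun|exact: continuous_Re].
Qed.

Lemma continuous_Im_comp h : continuous (fun y => complex.Im (h y)).
Proof.
by move=> y; apply: continuous_comp; [exact: cts_fun|exact: continuous_Im].
Qed.

Lemma iter_ReIm n (f : Mb R U) u :
  complex.Re (iter n Phi f u) = iter n P (fun y => complex.Re (f y)) u /\
  complex.Im (iter n Phi f u) = iter n P (fun y => complex.Im (f y)) u.
Proof.
elim: n u => [//|n IHn] u; rewrite !iterS; split.
  rewrite (PhiP _ u).1; congr (P _ u); apply/funext => v; exact: (IHn v).1.
rewrite (PhiP _ u).2; congr (P _ u); apply/funext => v; exact: (IHn v).2.
Qed.

Lemma fixed_ReImP G : Phi (restr cK U G) = restr cK U G <->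
  (forall u : U,
     P (on_U (fun y => complex.Re (G y))) u = complex.Re (G (\val u))) /\
  (forall u : U,
     P (on_U (fun y => complex.Im (G y))) u = complex.Im (G (\val u))).
Proof.
have RI u := PhiP (restr cK U G) u.
split=> [GG|[Gr Gi]].
  by split=> u; [rewrite -[LHS](RI u).1|rewrite -[LHS](RI u).2]; rewrite GG.
apply: val_inj; apply/funext => u.
have := (RI u).1; rewrite [RHS]Gr; have := (RI u).2; rewrite [RHS]Gi.
rewrite /=; case: (Mb_fun (Phi _) u) (G (\val u)) => [a b] [c d] /=.
by move=> -> ->.
Qed.

Lemma barrier_Re x h : h x = 0 -> (forall y, y <> x -> h y < 0) ->
  (forall u : U, restr cK U h u <= Phi (restr cK U h) u) -> has_barrier P x.
Proof.
move=> hx h0 sh; exists (fun y => complex.Re (h y)).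
  split=> [|u]; first exact: continuous_Re_comp.
  by have := sh u; rewrite lecE => /andP[_]; rewrite (PhiP _ u).1.
split=> [|y /h0]; first by rewrite hx.
by rewrite ltcE => /andP[].
Qed.

Lemma strong_max_real :
  (forall g : continuousType K R[i]^o,
     (forall x, g x \is Num.real) ->
     (forall u : U, restr cK U g u <= Phi (restr cK U g) u) ->
     (exists z, U z /\ forall x, g x <= g z) ->
     exists c, forall x, g x = c) ->
  forall g : K -> R, subharmonic P g ->
    (exists z, U z /\ forall x, g x <= g z) -> exists c, forall x, g x = c.
Proof.
move=> maxC g [cg sg] [z [Uz gz]].
have c0 : continuous (fun _ : K => 0 : R) by move=> y; exact: cvg_cst.
pose h : continuousType K R[i]^o := mkcts (continuous_complex cg c0).
have [x|u||c gc] := maxC h.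
- by rewrite realE !lecE /= !eqxx le_total.
- rewrite lecE (PhiP _ u).1 (PhiP _ u).2 /= (feller_cst avP) eqxx /=.
  exact: sg.
- by exists z; split=> // x; rewrite lecE /= eqxx /=; exact: gz.
- by exists (complex.Re c) => x; rewrite -(gc x).
Qed.

End reduction_to_real_parts.

Theorem theorem1 (R : realType) (K : metricType R) (cK : compact [set: K])
    (U : set K) (U_open : open U) (U_dense : dense U)
    (boundary_two : exists x y, [/\ boundary U x, boundary U y & x <> y])
    (Phi : {linear Mb R U -> Mb R U})
    (Phi_markov : markov_operator Phi)
    (Phi_feller : strong_feller Phi)
    (condA : forall x, boundary U x ->
       exists h : continuousType K R[i]^o,
         [/\ h x = 0,
             forall y, y <> x -> h y < 0 &
             forall u : U, restr cK U h u <= Phi (restr cK U h) u])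
    (condB : forall g : continuousType K R[i]^o,
       (forall x, g x \is Num.real) ->
       (forall u : U, restr cK U g u <= Phi (restr cK U g) u) ->
       (exists z, U z /\ forall x, g x <= g z) ->
       exists c, forall x, g x = c) :
  forall f : continuousType (boundary U) R[i]^o,
    exists G : continuousType K R[i]^o,
      unique (fun G' : continuousType K R[i]^o =>
                Phi (restr cK U G') = restr cK U G' /\
                forall x : boundary U, G' (\val x) = f x) G /\
      forall F : continuousType K R[i]^o,
        (forall x : boundary U, F (\val x) = f x) ->
        {uniform, (fun n => iter n Phi (restr cK U F) : U -> R[i]^o) @ \oo
           --> (restr cK U G : U -> R[i]^o)}.
Proof.
have [P avP PhiP] := strong_feller_average Phi_markov Phi_feller.
have bU := boundary_dense_open U_open U_dense.
have barrier x : ~ U x -> has_barrier P x.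
  move=> Ux; have [|h [hx h0 sh]] := condA x; first by rewrite bU.
  exact (barrier_Re (cK:=cK) PhiP hx h0 sh).
have outside : exists x, ~ U x.
  by have [x [y [Bx _ _]]] := boundary_two; exists x; move: Bx; rewrite bU.
have smax := strong_max_real avP PhiP condB.
have solve (F : continuousType K R[i]^o) : exists G : continuousType K R[i]^o,
    [/\ Phi (restr cK U G) = restr cK U G, forall x, ~ U x -> G x = F x &
     {uniform, (fun n => iter n Phi (restr cK U F) : U -> R[i]^o) @ \oo
        --> (restr cK U G : U -> R[i]^o)}].
  have [A [cA hA AF uA]] := real_dirichlet cK U_open avP barrier outside smax
    (@continuous_Re_comp _ _ F).
  have [B [cB hB BF uB]] := real_dirichlet cK U_open avP barrier outside smax
    (@continuous_Im_comp _ _ F).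
  exists (mkcts (continuous_complex cA cB)); split.
  - exact/(fixed_ReImP cK PhiP).
  - by move=> x Ux; rewrite /= /mkcts AF// BF//; case: (F x).
  - apply: uniform_cvg_complex => e e0.
      apply: filterS (uA e e0) => n + u => /(_ u).
      by rewrite (iter_ReIm PhiP n _ u).1.
    apply: filterS (uB e e0) => n + u => /(_ u).
    by rewrite (iter_ReIm PhiP n _ u).2.
have uniq_sol (G G' : continuousType K R[i]^o) :
    Phi (restr cK U G) = restr cK U G -> Phi (restr cK U G') = restr cK U G' ->
    (forall x, ~ U x -> G x = G' x) -> G = G'.
  move=> /(fixed_ReImP cK PhiP)[Gr Gi] /(fixed_ReImP cK PhiP)[Gr' Gi'] GG'.
  have Re_eq := harmonic_unique cK avP outside smax
    (@continuous_Re_comp _ _ G) (@continuous_Re_comp _ _ G') Gr Gr'.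
  have Im_eq := harmonic_unique cK avP outside smax
    (@continuous_Im_comp _ _ G) (@continuous_Im_comp _ _ G') Gi Gi'.
  apply/continuousEP => x.
  have /(congr1 (@^~ x))/= := Re_eq (fun y Uy => congr1 _ (GG' y Uy)).
  have /(congr1 (@^~ x))/= := Im_eq (fun y Uy => congr1 _ (GG' y Uy)).
  by case: (G x) (G' x) => [a b] [c d] /= -> ->.
move=> f.
have nK : normal_space K by exact: pseudometric_normal.
have clB : closed (boundary U) by rewrite bU; exact: open_closedC.
have [A cA Af] := tietze_set_type nK cK clB (@continuous_Re_comp _ _ f).
have [B cB Bf] := tietze_set_type nK cK clB (@continuous_Im_comp _ _ f).
have [G [GG GF GU]] := solve (mkcts (continuous_complex cA cB)).
have offU (F : continuousType K R[i]^o) :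
    (forall x : boundary U, F (\val x) = f x) ->
    forall x, ~ U x -> F x = G x.
  move=> Ff x Ux; have Bx : boundary U x by rewrite bU.
  rewrite GF//= /mkcts.
  rewrite -[x]/(\val (exist _ x (mem_set Bx) : boundary U)) Ff Af Bf.
  by case: (f _).
exists G; split.
  split=> [|G' [GG' G'f]].
    split=> // x; rewrite GF.
      by rewrite /= /mkcts Af Bf; case: (f x).
    by have := set_valP x; rewrite {1}bU.
  by apply: uniq_sol => // x Ux; rewrite (offU G').
move=> F Ff; have [G' [GG' G'F FU]] := solve F.
suff -> : G = G' by [].
by apply: uniq_sol => // x Ux; rewrite G'F// (offU F).
Qed.
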